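(* Let $\mathsf{Lic}$ be a coherent zone discipline on $\mathbf{Arch}_Z$ with extracted signature $\Sigma_{\mathsf{Lic}}=(Z,\preceq,\mathcal{W}_{\mathsf{Lic}},\mathcal{C}_{\mathsf{Lic}})$, and fix an assignment $\rho$ of atoms to objects of $\mathbf{Ctx}$. For every derivation $\pi$ of a sequent $\Gamma\vdash A$ in $\mathsf{TZ}_{\Sigma_{\mathsf{Lic}}}$ there exists a morphism $[\![\pi]\!]\colon[\![\Gamma]\!]\to\mathrm{Out}(A)$ of $\mathbf{Arch}_{\widehat Z}$ belonging to $\mathrm{Diag}_{\mathsf{Lic}}$. Moreover, if the last rule of $\pi$ is an instance of $\mathrm{W}_z$, then the construction of $[\![\pi]\!]$ uses the designated discard family $\omega_{z,-}$, and if the last rule of $\pi$ is an instance of $\mathrm{C}_z$, then the construction of $[\![\pi]\!]$ uses the designated diagonal family $\delta_{z,-}$.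
   Context: Let $\mathbf{Ctx}$ be a category with finite products, $Z$ a set of zones, $\mathsf{o}\notin Z$ and $\widehat Z=Z\sqcup\{\mathsf{o}\}$. For a label set $Y$, $\mathbf{Arch}_Y$ is the symmetric monoidal category whose objects are finite lists $((z_1,A_1),\dots,(z_n,A_n))$ with $z_i\in Y$, $A_i\in\mathrm{Ob}(\mathbf{Ctx})$ (carrier $A_1\times\cdots\times A_n$), whose morphisms $\Gamma\to\Delta$ are classes $[\![P,\varphi]\!]$ of pairs ($P$ an object, $\varphi\colon P\times[\![\Gamma]\!]\to[\![\Delta]\!]$) modulo isomorphic reparametrisation of $P$, with sequential composition, tensor given by concatenation, unit the empty list $\emptyset$; $J_z(A)=((z,A))$, $J_z(f)=[\![1,f\circ\pi_2]\!]$. $\mathbf{Arch}_Z$ sits canonically inside $\mathbf{Arch}_{\widehat Z}$. A coherent zone discipline $\mathsf{Lic}$ consists of a preorder $\preceq$ on $Z$, natural coercions $\chi_{z,z',X}\colon J_z(X)\to J_{z'}(X)$ for $z\preceq z'$ (identity when $z=z'$, closed under composition), upward-closed $\mathcal{W}_{\mathsf{Lic}},\mathcal{C}_{\mathsf{Lic}}\subseteq Z$, discards $\omega_{z,X}\colon J_z(X)\to\emptyset$ for $z\in\mathcal{W}_{\mathsf{Lic}}$ and diagonals $\delta_{z,X}\colon J_z(X)\to J_z(X)\otimes J_z(X)$ for $z\in\mathcal{C}_{\mathsf{Lic}}$, all natural in $X$ and compatible with coercions. Tensorial formulas: $A::=p\mid I\mid A\otimes B$; zone contexts are finite multisets of $z{:}A$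 with $z\in Z$. $\mathsf{TZ}_{\Sigma}$ for $\Sigma=(Z,\preceq,\mathcal{W},\mathcal{C})$ has rules: axiom $z{:}A\vdash A$; $\emptyset\vdash I$; $\otimes\mathrm{R}$ (from $\Gamma\vdash A$, $\Delta\vdash B$ infer $\Gamma,\Delta\vdash A\otimes B$); $\otimes\mathrm{L}$ (from $\Gamma,z{:}A,z{:}B\vdash C$ infer $\Gamma,z{:}A\otimes B\vdash C$); $I\mathrm{L}$ (from $\Gamma\vdash C$ infer $\Gamma,z{:}I\vdash C$); cut (from $\Gamma\vdash A$ and $\Delta,z{:}A\vdash B$ infer $\Gamma,\Delta\vdash B$); $\mathrm{W}_z$ for $z\in\mathcal{W}$ (from $\Gamma\vdash B$ infer $\Gamma,z{:}A\vdash B$); $\mathrm{C}_z$ for $z\in\mathcal{C}$ (from $\Gamma,z{:}A,z{:}A\vdash B$ infer $\Gamma,z{:}A\vdash B$). Semantics: $[\![p]\!]=\rho(p)$, $[\![I]\!]=1$, $[\![A\otimes B]\!]=[\![A]\!]\times[\![B]\!]$; for an ordered representative $\Gamma=(z_1{:}A_1,\dots,z_n{:}A_n)$, $[\![\Gamma]\!]=J_{z_1}([\![A_1]\!])\otimes\cdots\otimes J_{z_n}([\![A_n]\!])$ (and $[\![\emptyset]\!]=\emptyset$); different orderings give objects related by canonical symmetric monoidal isomorphisms. $\mathrm{Out}(A)=J_{\mathsf{o}}([\![A]\!])$. Interface blocks (for $z\in Z$, formulas $A,B$): $r_{z,A}\colon J_z([\![A]\!])\to\mathrm{Out}(A)$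 and $\iota_{z,A}\colon\mathrm{Out}(A)\to J_z([\![A]\!])$, both the class of $(1,\pi_2)$ (induced by $\mathrm{id}_{[\![A]\!]}$); $\tau_{A,B}\colon\mathrm{Out}(A)\otimes\mathrm{Out}(B)\to\mathrm{Out}(A\otimes B)$ and $\mu_{z,A,B}\colon J_z([\![A\otimes B]\!])\to J_z([\![A]\!])\otimes J_z([\![B]\!])$ induced by the identity of $[\![A]\!]\times[\![B]\!]$; $\eta\colon\emptyset\to\mathrm{Out}(I)$ induced by $\mathrm{id}_1$; $\nu_z\colon J_z(1)\to\emptyset$ induced by $1\to1$. $\mathrm{Diag}_{\mathsf{Lic}}$ is the smallest class of morphisms in $\mathbf{Arch}_{\widehat Z}$ containing all identities, associators, unitors, symmetries, all interface blocks, all coercions $\chi_{z,z',X}$, all discards $\omega_{z,X}$ ($z\in\mathcal{W}_{\mathsf{Lic}}$), all diagonals $\delta_{z,X}$ ($z\in\mathcal{C}_{\mathsf{Lic}}$), and closed under composition and tensor product. *)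

(* Defs.v *)
From HB Require Import structures.
From mathcomp Require Import all_boot.
From mathcomp Require Import generic_quotient finmap multiset boolp.

Set Implicit Arguments.
Unset Strict Implicit.
Unset Printing Implicit Defensive.

Declare Scope arch_scope.
Delimit Scope arch_scope with arch.
Local Open Scope quotient_scope.

Record fpcat := FPCat {
  ob :> Type;
  hom : ob -> ob -> Type;
  idm : forall A, hom A A;
  cmp : forall A B C, hom B C -> hom A B -> hom A C;
  cmp1m : forall A B (f : hom A B), cmp (idm B) f = f;
  cmpm1 : forall A B (f : hom A B), cmp f (idm A) = f;
  cmpA : forall A B C D (h : hom C D) (g : hom B C) (f : hom A B),
    cmp h (cmp g f) = cmp (cmp h g) f;
  tobj : ob;
  bang : forall A, hom A tobj;
  bang_uniq : forall A (f : hom A tobj), f = bang A;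
  prd : ob -> ob -> ob;
  pr1 : forall A B, hom (prd A B) A;
  pr2 : forall A B, hom (prd A B) B;
  pairing : forall X A B, hom X A -> hom X B -> hom X (prd A B);
  pr1_pair : forall X A B (f : hom X A) (g : hom X B),
    cmp (pr1 A B) (pairing f g) = f;
  pr2_pair : forall X A B (f : hom X A) (g : hom X B),
    cmp (pr2 A B) (pairing f g) = g;
  pair_uniq : forall X A B (h : hom X (prd A B)),
    h = pairing (cmp (pr1 A B) h) (cmp (pr2 A B) h) }.

Arguments hom {_}.
Arguments idm {_} A.
Arguments cmp {_ A B C}.
Arguments tobj {_}.
Arguments bang {_} A.
Arguments bang_uniq {_ A}.
Arguments prd {_}.
Arguments pr1 {_} A B.
Arguments pr2 {_} A B.
Arguments pairing {_ X A B}.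

Local Notation "g \c f" := (cmp g f) (at level 50, left associativity).
Local Notation "f \x g" := (pairing (f \c pr1 _ _) (g \c pr2 _ _))
  (at level 40, left associativity).

Section CartesianFacts.
Variable C : fpcat.
Implicit Types A B X Y : C.

Lemma pair_cmp X Y A B (f : hom X A) (g : hom X B) (h : hom Y X) :
  pairing f g \c h = pairing (f \c h) (g \c h).
Proof. by rewrite [LHS]pair_uniq !cmpA pr1_pair pr2_pair. Qed.

Lemma pair_pr A B : pairing (pr1 A B) (pr2 A B) = idm (prd A B).
Proof. by rewrite [RHS]pair_uniq !cmpm1. Qed.

Lemma cmpAr X Y A B (h : hom A B) (g : hom Y A) (f : hom X Y) :
  h \c g \c f = h \c (g \c f).
Proof. by rewrite cmpA. Qed.

End CartesianFacts.

Definition cartE := (cmp1m, cmpm1, cmpAr, pair_cmp, pr1_pair, pr2_pair).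

Section Para.
Variable C : fpcat.
Implicit Types A B : C.

Record para A B := Para { param : C; pfun : hom (prd param A) B }.

HB.instance Definition _ A B := gen_eqMixin (para A B).
HB.instance Definition _ A B := gen_choiceMixin (para A B).

Definition reparam A B (p q : para A B) : Prop :=
  exists (a : hom (param p) (param q)) (b : hom (param q) (param p)),
    [/\ b \c a = idm _, a \c b = idm _ & pfun p = pfun q \c (a \x idm A)].

Lemma reparam_refl A B (p : para A B) : reparam p p.
Proof.
exists (idm _), (idm _); split; rewrite ?cmp1m //.
by rewrite pair_pr cmpm1.
Qed.

Lemma reparam_sym A B (p q : para A B) : reparam p q -> reparam q p.
Proof.
move=> [a [b [ba ab e]]]; exists b, a; split=> //.
by rewrite e !cartE -cmpAr ab cmp1m pair_pr cmpm1.
Qed.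

Lemma reparam_trans A B (p q r : para A B) :
  reparam p q -> reparam q r -> reparam p r.
Proof.
move=> [a [b [ba ab e]]] [a' [b' [ba' ab' e']]].
exists (a' \c a), (b \c b'); split.
- by rewrite cmpA -(cmpA b) ba' cmpm1.
- by rewrite cmpA -(cmpA a') ab cmpm1.
- by rewrite e e' !cartE.
Qed.

Definition reparamb A B : rel (para A B) := fun p q => `[< reparam p q >].

Lemma reparamb_refl A B : reflexive (@reparamb A B).
Proof. by move=> p; apply/asboolP/reparam_refl. Qed.

Lemma reparamb_sym A B : symmetric (@reparamb A B).
Proof. by move=> p q; apply/asboolP/asboolP; apply: reparam_sym. Qed.

Lemma reparamb_trans A B : transitive (@reparamb A B).
Proof.
by move=> q p r /asboolP pq /asboolP qr; apply/asboolP/(reparam_trans pq qr).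
Qed.

Canonical reparam_equiv A B :=
  EquivRel (@reparamb A B) (@reparamb_refl A B) (@reparamb_sym A B)
    (@reparamb_trans A B).

Definition para_class A B : Type := {eq_quot (@reparamb A B)}.

Definition to_class A B (p : para A B) : para_class A B :=
  \pi_({eq_quot (@reparamb A B)}) p.

Definition of_class A B (f : para_class A B) : para A B :=
  repr (f : {eq_quot (@reparamb A B)}).

Lemma to_classP A B (p q : para A B) :
  to_class p = to_class q <-> reparam p q.
Proof.
split; first by move=> /eqmodP/asboolP.
by move=> pq; apply/eqmodP/asboolP.
Qed.

Lemma of_classK A B (f : para_class A B) : to_class (of_class f) = f.
Proof. exact: reprK. Qed.

Lemma of_to_class A B (p : para A B) : reparam (of_class (to_class p)) p.
Proof. by apply/to_classP; rewrite of_classK. Qed.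

End Para.

Section Arch.
Variables (C : fpcat) (Y : Type).
Implicit Types (G D T : seq (Y * C)) (y : Y) (X : C).

(* [A1 * (A2 * (... * An))]; it is [tobj] on the empty list and [A] itself on
   a one-element list. *)
Fixpoint carrier G : C :=
  match G with
  | [::] => tobj
  | x :: G' => match G' with [::] => x.2 | _ => prd x.2 (carrier G') end
  end.

Definition hd x G : hom (carrier (x :: G)) x.2 :=
  match G with [::] => idm _ | _ => pr1 _ _ end.

Definition tl x G : hom (carrier (x :: G)) (carrier G) :=
  match G with [::] => bang _ | _ => pr2 _ _ end.

Definition cns x G : hom (prd x.2 (carrier G)) (carrier (x :: G)) :=
  match G with [::] => pr1 _ _ | _ => idm _ end.

Fixpoint takec G D : hom (carrier (G ++ D)) (carrier G) :=
  match G with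
  | [::] => bang _
  | x :: G' => cns x G' \c pairing (hd x (G' ++ D)) (takec G' D \c tl x (G' ++ D))
  end.

Fixpoint dropc G D : hom (carrier (G ++ D)) (carrier D) :=
  match G with
  | [::] => idm _
  | x :: G' => dropc G' D \c tl x (G' ++ D)
  end.

(* [csplit] and [cmerge] are the canonical isomorphism
   [carrier (G ++ D) ~ carrier G * carrier D] and its inverse. *)
Definition csplit G D : hom (carrier (G ++ D)) (prd (carrier G) (carrier D)) :=
  pairing (takec G D) (dropc G D).

Fixpoint cmerge G D : hom (prd (carrier G) (carrier D)) (carrier (G ++ D)) :=
  match G with
  | [::] => pr2 _ _
  | x :: G' =>
      cns x (G' ++ D) \c
      pairing (hd x G' \c pr1 _ _) (cmerge G' D \c pairing (tl x G' \c pr1 _ _) (pr2 _ _))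
  end.

Lemma hd_cns x G : hd x G \c cns x G = pr1 _ _.
Proof. by case: G => [|y G]; rewrite /= ?cmp1m ?cmpm1. Qed.

Lemma tl_cns x G : tl x G \c cns x G = pr2 _ _.
Proof.
case: G => [|y G]; rewrite /= ?cmpm1 //.
by rewrite [LHS]bang_uniq [RHS]bang_uniq.
Qed.

Lemma cns_hd_tl x G : cns x G \c pairing (hd x G) (tl x G) = idm _.
Proof. by case: G => [|y G]; rewrite /= ?cmp1m ?pair_pr ?pr1_pair. Qed.

Lemma takec_merge G D : takec G D \c cmerge G D = pr1 _ _.
Proof.
elim: G => [|x G IH]; first by rewrite [LHS]bang_uniq [RHS]bang_uniq.
rewrite [takec _ _]/= [cmerge _ _]/= !cartE.
rewrite -(cmpAr (hd _ _)) hd_cns -(cmpAr (tl _ _)) tl_cns !cartE.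
by rewrite -(cmpAr (takec G D)) IH pr1_pair -pair_cmp -cmpAr cns_hd_tl cmp1m.
Qed.

Lemma dropc_merge G D : dropc G D \c cmerge G D = pr2 _ _.
Proof.
elim: G => [|x G IH]; first by rewrite /= cmp1m.
rewrite [dropc _ _]/= [cmerge _ _]/= !cartE.
by rewrite -(cmpAr (tl _ _)) tl_cns !cartE -cmpAr IH pr2_pair.
Qed.

Lemma cmergeK G D : csplit G D \c cmerge G D = idm _.
Proof. by rewrite pair_cmp takec_merge dropc_merge pair_pr. Qed.

Lemma csplitK G D : cmerge G D \c csplit G D = idm _.
Proof.
rewrite /csplit; elim: G => [|x G IH]; first by rewrite /= pr2_pair.
rewrite [takec _ _]/= [dropc _ _]/= [cmerge _ _]/= !cartE.
rewrite -(cmpAr (hd _ _)) hd_cns -(cmpAr (tl _ _)) tl_cns !cartE.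
by rewrite -pair_cmp -cmpAr IH cmp1m cns_hd_tl.
Qed.

Definition arch G D : Type := para_class (carrier G) (carrier D).

Definition cls G D (P : C) (phi : hom (prd P (carrier G)) (carrier D)) :
  arch G D := to_class (Para phi).

Definition pure G D (f : hom (carrier G) (carrier D)) : arch G D :=
  cls (f \c pr2 tobj (carrier G)).

Definition arch_id G : arch G G := pure (idm _).

Definition comp_para (A B E : C) (q : para B E) (p : para A B) : para A E :=
  Para (pfun q \c
    pairing (pr1 (param q) (param p) \c pr1 _ A)
         (pfun p \c pairing (pr2 (param q) (param p) \c pr1 _ A) (pr2 _ A))).

Definition arch_comp G D T (g : arch D T) (f : arch G D) : arch G T :=
  to_class (comp_para (of_class g) (of_class f)).

Definition tens_para G D G' D'
    (p : para (carrier G) (carrier D)) (q : para (carrier G') (carrier D')) :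
    para (carrier (G ++ G')) (carrier (D ++ D')) :=
  Para (cmerge D D' \c
    pairing (pfun p \c pairing (pr1 (param p) (param q) \c pr1 _ _)
                         (takec G G' \c pr2 _ _))
         (pfun q \c pairing (pr2 (param p) (param q) \c pr1 _ _)
                         (dropc G G' \c pr2 _ _))).

Definition arch_tens G D G' D' (f : arch G D) (g : arch G' D') :
    arch (G ++ G') (D ++ D') :=
  to_class (tens_para (of_class f) (of_class g)).

(* Composition and tensor do not depend on the chosen representatives. *)
Lemma arch_compE G D T P Q (psi : hom (prd Q (carrier D)) (carrier T))
    (phi : hom (prd P (carrier G)) (carrier D)) :
  arch_comp (cls psi) (cls phi) = to_class (comp_para (Para psi) (Para phi)).
Proof.
apply/to_classP; rewrite /cls.
have [a [a' [aK aK' ea]]] := of_to_class (Para psi).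
have [b [b' [bK bK' eb]]] := of_to_class (Para phi).
exists (a \x b), (a' \x b'); split.
- by rewrite /= !cartE -!cmpAr aK bK !cmp1m pair_pr.
- by rewrite /= !cartE -!cmpAr aK' bK' !cmp1m pair_pr.
- by rewrite /= ea eb /= !cartE.
Qed.

Lemma arch_tensE G D G' D' P Q (phi : hom (prd P (carrier G)) (carrier D))
    (psi : hom (prd Q (carrier G')) (carrier D')) :
  arch_tens (cls phi) (cls psi) = to_class (tens_para (Para phi) (Para psi)).
Proof.
apply/to_classP; rewrite /cls.
have [a [a' [aK aK' ea]]] := of_to_class (Para phi).
have [b [b' [bK bK' eb]]] := of_to_class (Para psi).
exists (a \x b), (a' \x b'); split.
- by rewrite /= !cartE -!cmpAr aK bK !cmp1m pair_pr.
- by rewrite /= !cartE -!cmpAr aK' bK' !cmp1m pair_pr.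
- by rewrite /= ea eb /= !cartE.
Qed.

(* The structural isomorphisms are induced by those of the cartesian category
   along the identification of [carrier (G ++ D)] with a binary product. *)
Definition assoc G D T : arch ((G ++ D) ++ T) (G ++ (D ++ T)) :=
  pure (cmerge G (D ++ T) \c
    pairing (takec G D \c takec (G ++ D) T)
         (cmerge D T \c pairing (dropc G D \c takec (G ++ D) T) (dropc (G ++ D) T))).

Definition assoc_inv G D T : arch (G ++ (D ++ T)) ((G ++ D) ++ T) :=
  pure (cmerge (G ++ D) T \c
    pairing (cmerge G D \c pairing (takec G (D ++ T)) (takec D T \c dropc G (D ++ T)))
         (dropc D T \c dropc G (D ++ T))).

Definition lunit G : arch ([::] ++ G) G := pure (dropc [::] G).

Definition lunit_inv G : arch G ([::] ++ G) :=
  pure (cmerge [::] G \c pairing (bang _) (idm _)).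

Definition runit G : arch (G ++ [::]) G := pure (takec G [::]).

Definition runit_inv G : arch G (G ++ [::]) :=
  pure (cmerge G [::] \c pairing (idm _) (bang _)).

Definition symm G D : arch (G ++ D) (D ++ G) :=
  pure (cmerge D G \c pairing (dropc G D) (takec G D)).

Definition J y X : seq (Y * C) := [:: (y, X)].

Definition Jmap y X X' (f : hom X X') : arch (J y X) (J y X') :=
  pure (f : hom (carrier (J y X)) (carrier (J y X'))).

End Arch.

Arguments arch {C Y} G D.
Arguments arch_id {C Y} G.
Arguments arch_comp {C Y G D T} g f.
Arguments arch_tens {C Y G D G' D'} f g.
Arguments pure {C Y} G D f.
Arguments J {C Y} y X.
Arguments Jmap {C Y} y {X X'} f.
Arguments assoc {C Y} G D T.
Arguments assoc_inv {C Y} G D T.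
Arguments lunit {C Y} G.
Arguments lunit_inv {C Y} G.
Arguments runit {C Y} G.
Arguments runit_inv {C Y} G.
Arguments symm {C Y} G D.

Notation "g \oA f" := (arch_comp g f)
  (at level 50, left associativity) : arch_scope.
Notation "f \xA g" := (arch_tens f g)
  (at level 40, left associativity) : arch_scope.

Local Open Scope arch_scope.

(* The label set [Z + {o}] is [option Z], with [o] as [None]. *)

Section Inclusion.
Variables (C : fpcat) (Z : Type).
Implicit Types G D : seq (Z * C).

Definition incl_ob G : seq (option Z * C) := [seq (Some x.1, x.2) | x <- G].

Lemma carrier_incl G : carrier (incl_ob G) = carrier G.
Proof. by elim: G => [|x [|y G] IH] //; exact (f_equal (prd x.2) IH). Defined.

(* The inclusion only changes labels: it is the identity on representatives. *)
Definition incl G D (f : arch G D) : arch (incl_ob G) (incl_ob D) :=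
  ecast A (para_class A (carrier (incl_ob D))) (esym (carrier_incl G))
    (ecast B (para_class (carrier G) B) (esym (carrier_incl D)) f).

End Inclusion.

Record zone_signature (Z : Type) := ZoneSignature {
  zle : Z -> Z -> Prop;
  weak : Z -> Prop;
  contr : Z -> Prop }.

(* [disc] and [diag] take a proof that the zone is licensed as an argument;
   independence of that proof follows from [coerc_id] and the compatibility
   with coercions along [dle_refl]. *)
Record zone_discipline (C : fpcat) (Z : Type) := ZoneDiscipline {
  dle : Z -> Z -> Prop;
  dle_refl : forall z, dle z z;
  dle_trans : forall z1 z2 z3, dle z1 z2 -> dle z2 z3 -> dle z1 z3;
  dweak : Z -> Prop;
  dweak_up : forall z z', dle z z' -> dweak z -> dweak z';
  dcontr : Z -> Prop;
  dcontr_up : forall z z', dle z z' -> dcontr z -> dcontr z';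
  coerc : forall z z', dle z z' -> forall X : C, arch (J z X) (J z' X);
  coerc_nat : forall z z' (h : dle z z') (X X' : C) (f : hom X X'),
    coerc h X' \oA Jmap z f = Jmap z' f \oA coerc h X;
  coerc_id : forall z (h : dle z z) X, coerc h X = arch_id (J z X);
  coerc_comp : forall z1 z2 z3 (h12 : dle z1 z2) (h23 : dle z2 z3)
      (h13 : dle z1 z3) X,
    coerc h23 X \oA coerc h12 X = coerc h13 X;
  disc : forall z, dweak z -> forall X : C, arch (J z X) [::];
  disc_nat : forall z (h : dweak z) (X X' : C) (f : hom X X'),
    disc h X' \oA Jmap z f = disc h X;
  disc_coerc : forall z z' (h : dle z z') (w : dweak z) (w' : dweak z') X,
    disc w' X \oA coerc h X = disc w X;
  diag : forall z, dcontr z -> forall X : C, arch (J z X) (J z X ++ J z X);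
  diag_nat : forall z (h : dcontr z) (X X' : C) (f : hom X X'),
    diag h X' \oA Jmap z f = (Jmap z f \xA Jmap z f) \oA diag h X;
  diag_coerc : forall z z' (h : dle z z') (c : dcontr z) (c' : dcontr z') X,
    diag c' X \oA coerc h X = (coerc h X \xA coerc h X) \oA diag c X }.

Definition extracted_signature (C : fpcat) (Z : Type)
    (L : zone_discipline C Z) : zone_signature Z :=
  ZoneSignature (dle L) (dweak L) (dcontr L).

Inductive form (atom : Type) : Type :=
| Atom of atom
| Unit
| Tensor of form atom & form atom.

Arguments Unit {atom}.

Record zform (Z atom : Type) := ZForm { zone : Z; fml : form atom }.

(* [{mset _}] requires a choiceType. *)
HB.instance Definition _ Z atom := gen_eqMixin (zform Z atom).
HB.instance Definition _ Z atom := gen_choiceMixin (zform Z atom).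

Notation zctx Z atom := {mset zform Z atom}%mset.

Section TZ.
Local Open Scope mset_scope.
Variables (Z atom : Type) (S : zone_signature Z).
Implicit Types (G D : zctx Z atom) (A B E : form atom) (z : Z).

Inductive TZ : zctx Z atom -> form atom -> Type :=
| TZ_ax z A : TZ [mset ZForm z A] A
| TZ_unitR : TZ mset0 Unit
| TZ_tensR G D A B : TZ G A -> TZ D B -> TZ (G `+` D) (Tensor A B)
| TZ_tensL G z A B E :
    TZ (G `+` [mset ZForm z A] `+` [mset ZForm z B]) E ->
    TZ (G `+` [mset ZForm z (Tensor A B)]) E
| TZ_unitL G z E : TZ G E -> TZ (G `+` [mset ZForm z Unit]) E
| TZ_cut G D z A B :
    TZ G A -> TZ (D `+` [mset ZForm z A]) B -> TZ (G `+` D) B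
| TZ_weak G z A B : weak S z -> TZ G B -> TZ (G `+` [mset ZForm z A]) B
| TZ_contr G z A B : contr S z ->
    TZ (G `+` [mset ZForm z A] `+` [mset ZForm z A]) B ->
    TZ (G `+` [mset ZForm z A]) B.

End TZ.

Section Semantics.
Variables (C : fpcat) (Z atom : Type) (rho : atom -> C).
Implicit Types (A B : form atom) (z : Z).

Fixpoint fsem A : C :=
  match A with
  | Atom p => rho p
  | Unit => tobj
  | Tensor A B => prd (fsem A) (fsem B)
  end.

Definition Jzf (x : zform Z atom) : seq (option Z * C) :=
  J (Some (zone x)) (fsem (fml x)).

Fixpoint csem (s : seq (zform Z atom)) : seq (option Z * C) :=
  match s with
  | [::] => [::]
  | x :: s' => Jzf x ++ csem s'
  end.

Definition Out A : seq (option Z * C) := J None (fsem A).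

(* The canonical symmetric monoidal isomorphisms between the semantics of two
   orderings of the same context: composites of exchanges of adjacent entries. *)
Inductive reordering : forall s t, arch (csem s) (csem t) -> Prop :=
| reord_id s : reordering (arch_id (csem s))
| reord_skip x s t (f : arch (csem s) (csem t)) :
    reordering f ->
    @reordering (x :: s) (x :: t) (arch_id (Jzf x) \xA f)
| reord_swap x y s :
    @reordering (x :: y :: s) (y :: x :: s)
      (symm (Jzf x) (Jzf y) \xA arch_id (csem s))
| reord_trans s t u (g : arch (csem t) (csem u)) (f : arch (csem s) (csem t)) :
    reordering g -> reordering f -> reordering (g \oA f).

Definition rblock z A : arch (J (Some z) (fsem A)) (Out A) :=
  pure (J (Some z) (fsem A)) (Out A) (idm (fsem A)).

Definition iblock z A : arch (Out A) (J (Some z) (fsem A)) :=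
  pure (Out A) (J (Some z) (fsem A)) (idm (fsem A)).

Definition tblock A B : arch (Out A ++ Out B) (Out (Tensor A B)) :=
  pure (Out A ++ Out B) (Out (Tensor A B)) (idm (prd (fsem A) (fsem B))).

Definition mblock z A B :
    arch (J (Some z) (fsem (Tensor A B)))
         (J (Some z) (fsem A) ++ J (Some z) (fsem B)) :=
  pure (J (Some z) (fsem (Tensor A B)))
       (J (Some z) (fsem A) ++ J (Some z) (fsem B))
       (idm (prd (fsem A) (fsem B))).

Definition eblock : arch [::] (Out Unit) := pure [::] (Out Unit) (idm tobj).

Definition nblock z : arch (J (Some z) (tobj : C)) [::] :=
  pure (J (Some z) (tobj : C)) [::] (idm tobj).

Variable L : zone_discipline C Z.

Definition coercO z z' (h : dle L z z') (X : C) :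
  arch (J (Some z) X) (J (Some z') X) := incl (coerc h X).

Definition discO z (h : dweak L z) (X : C) : arch (J (Some z) X) [::] :=
  incl (disc h X).

Definition diagO z (h : dcontr L z) (X : C) :
  arch (J (Some z) X) (J (Some z) X ++ J (Some z) X) := incl (diag h X).

(* Associators and unitors are taken in both directions, as isomorphisms. *)
Inductive Diag : forall G D : seq (option Z * C), arch G D -> Prop :=
| Diag_id G : Diag (arch_id G)
| Diag_assoc G D T : Diag (assoc G D T)
| Diag_assoc_inv G D T : Diag (assoc_inv G D T)
| Diag_lunit G : Diag (lunit G)
| Diag_lunit_inv G : Diag (lunit_inv G)
| Diag_runit G : Diag (runit G)
| Diag_runit_inv G : Diag (runit_inv G)
| Diag_symm G D : Diag (symm G D)
| Diag_r z A : Diag (rblock z A)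
| Diag_i z A : Diag (iblock z A)
| Diag_t A B : Diag (tblock A B)
| Diag_m z A B : Diag (mblock z A B)
| Diag_e : Diag eblock
| Diag_n z : Diag (nblock z)
| Diag_coerc z z' (h : dle L z z') X : Diag (coercO h X)
| Diag_disc z (h : dweak L z) X : Diag (discO h X)
| Diag_diag z (h : dcontr L z) X : Diag (diagO h X)
| Diag_comp G D T (g : arch D T) (f : arch G D) :
    Diag g -> Diag f -> Diag (g \oA f)
| Diag_tens G D G' D' (f : arch G D) (g : arch G' D') :
    Diag f -> Diag g -> Diag (f \xA g).

End Semantics.

Arguments Out {C Z atom} rho A.
Arguments reordering {C Z atom} rho {s t} _.
Arguments Diag {C Z atom} rho L {G D} _.

(* Main.v *)
(** A derivation is interpreted by recursion, each rule being sent to a composite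
of one interface block (or a discard, or a diagonal) padded with identities.
Contexts are multisets read through the chosen ordering [ord], so every rule
also needs a reordering that brings its principal entries to the front; a
permutation of entries is a composite of adjacent exchanges, and so lies in
[Diag]. *)

Require Import Defs.
From HB Require Import structures.
From mathcomp Require Import all_boot.
From mathcomp Require Import finmap multiset boolp.

Set Implicit Arguments.
Unset Strict Implicit.
Unset Printing Implicit Defensive.

Local Open Scope mset_scope.
Local Open Scope arch_scope.

Section Reordering.
Variables (C : fpcat) (Z atom : Type) (rho : atom -> C).
Implicit Types (s t : seq (zform Z atom)) (x : zform Z atom).

(** Concatenation of lists is strictly associative, so this is an equality of objects; transport
    along it replaces any associator. *)
Lemma csem_cat s t : csem rho (s ++ t) = csem rho s ++ csem rho t.
Proof. by elim: s => //= x s ->. Qed.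

Lemma reordering_rotate x s t :
  exists f : arch (csem rho (x :: s ++ t)) (csem rho (s ++ x :: t)),
    reordering rho f.
Proof.
elim: s => [|y s [f rf]]; first by exists (arch_id _); exact: reord_id.
(* Since [Jzf] is a one-element list, both tensors have, up to conversion, the [csem] of a list as
   domain and codomain; the ascription makes this visible for [f]. *)
exists ((arch_id (Jzf rho y) \xA f : arch (csem rho (y :: x :: s ++ t))
                                         (csem rho (y :: s ++ x :: t)))
  \oA (symm (Jzf rho x) (Jzf rho y) \xA arch_id (csem rho (s ++ t)))).
exact: reord_trans (reord_skip y rf) (reord_swap rho x y _).
Qed.

(** Insertion argument: locate the head of [s] in [t], reorder the tails by induction, then rotate
    the head into its place. *)
Lemma reordering_perm s t : perm_eq s t ->
  exists f : arch (csem rho s) (csem rho t), reordering rho f.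
Proof.
elim: s t => [|x s IH] t pst.
  rewrite perm_sym in pst; rewrite (perm_nilP pst).
  by exists (arch_id _); exact: reord_id.
have xt : x \in t by rewrite -(perm_mem pst) mem_head.
case/splitPr: xt pst => t1 t2.
rewrite perm_sym -[x :: t2]cat1s perm_catCA /= perm_cons perm_sym.
move=> /IH[f rf]; have [g rg] := reordering_rotate x t1 t2.
exists (g \oA (arch_id (Jzf rho x) \xA f)).
exact: reord_trans rg (reord_skip x rf).
Qed.

Lemma reordering_Diag (L : zone_discipline C Z) s t
    (f : arch (csem rho s) (csem rho t)) :
  reordering rho f -> Diag rho L f.
Proof.
elim=> {s t f} [s|x s t f _ df|x y s|s t u g f _ dg _ df].
- exact: Diag_id.
- exact: Diag_tens (Diag_id rho L (Jzf rho x)) df.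
- exact: Diag_tens (Diag_symm rho L (Jzf rho x) (Jzf rho y))
    (Diag_id rho L (csem rho s)).
- exact: Diag_comp dg df.
Qed.

End Reordering.

Section Interpretation.
Variables (C : fpcat) (Z : Type) (L : zone_discipline C Z).
Variables (atom : Type) (rho : atom -> C).
Variables (ord : zctx Z atom -> seq (zform Z atom)).
(** [ord] is an arbitrary section of [seq_mset], so every choice of ordered representatives is
    covered. *)
Hypothesis ordK : forall G, seq_mset (ord G) = G.
Implicit Types (G D : zctx Z atom) (A B : form atom) (z : Z).
Implicit Types (s t : seq (zform Z atom)) (x y : zform Z atom).

Local Notation sem G := (csem rho (ord G)).

Lemma count_ord G x : count_mem x (ord G) = G x.
Proof. by rewrite -mset_seqE ordK. Qed.

(** Reduces each comparison of an ordered context with an explicit list to a count of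
    multiplicities. *)
Lemma perm_ord s G : (forall x, count_mem x s = G x) -> perm_eq (ord G) s.
Proof. by move=> sG; apply/allP=> x _ /=; rewrite count_ord sG. Qed.

Lemma perm_ord0 : perm_eq (ord mset0) [::].
Proof. by apply: perm_ord => x; rewrite mset0E. Qed.

Lemma perm_ordD G D : perm_eq (ord (G `+` D)) (ord G ++ ord D).
Proof. by apply: perm_ord => x; rewrite count_cat !count_ord msetE2. Qed.

Lemma perm_ord1 x : perm_eq (ord [mset x]) [:: x].
Proof. by apply: perm_ord => y; rewrite /= addn0 msetnE eq_sym; case: ifP. Qed.

Lemma perm_ordD1 G x : perm_eq (ord (G `+` [mset x])) (x :: ord G).
Proof.
by rewrite (permPl (perm_ordD _ _)) perm_catC -cat1s perm_cat2r perm_ord1.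
Qed.

(** Oriented from the explicit list to the chosen ordering: it is applied after a block has produced
    two entries, to reach the context of the premise. *)
Lemma perm_ordD2 G x y :
  perm_eq (x :: y :: ord G) (ord (G `+` [mset x] `+` [mset y])).
Proof.
rewrite (perm_catCA [:: x] [:: y]) perm_sym (permPl (perm_ordD1 _ _)).
by rewrite perm_cons perm_ordD1.
Qed.

(** A permutation only guarantees that some reordering exists, so one is selected by choice;
    membership in [Diag] holds for any selection. *)
Definition reorder s t (st : perm_eq s t) : arch (csem rho s) (csem rho t) :=
  projT1 (cid (reordering_perm rho st)).

Lemma reorderP s t (st : perm_eq s t) : reordering rho (reorder st).
Proof. exact: projT2 (cid (reordering_perm rho st)). Qed.

Definition split_sem G D : arch (sem (G `+` D)) (sem G ++ sem D) :=
  ecast X (arch (sem (G `+` D)) X) (csem_cat rho (ord G) (ord D))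
    (reorder (perm_ordD G D)).

Lemma split_sem_Diag G D : Diag rho L (split_sem G D).
Proof.
(* Eliminating the equation of codomains turns the cast into the identity. *)
rewrite /split_sem; case: _ / (csem_cat rho (ord G) (ord D)).
exact/reordering_Diag/reorderP.
Qed.

Local Notation pick1 G x := (reorder (perm_ordD1 G x)).
Local Notation put2 G x y := (reorder (perm_ordD2 G x y)).

(** Read each composite from right to left: rearrange the context of the conclusion, apply the block
    of the rule, then run the premises. *)
Fixpoint interp G A (pi : TZ (extracted_signature L) G A) :
    arch (sem G) (Out rho A) :=
  match pi in TZ _ G A return arch (sem G) (Out rho A) with
  | TZ_ax z A =>
      rblock rho z A \oA reorder (perm_ord1 (ZForm z A))
  | TZ_unitR => eblock Z rho \oA reorder perm_ord0
  | TZ_tensR G D A B p q =>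
      tblock Z rho A B \oA (interp p \xA interp q) \oA split_sem G D
  | TZ_tensL G z A B E p =>
      interp p \oA put2 G (ZForm z A) (ZForm z B)
        \oA (mblock rho z A B \xA arch_id (sem G))
        \oA pick1 G (ZForm z (Tensor A B))
  | TZ_unitL G z E p =>
      interp p \oA lunit (sem G) \oA (nblock C z \xA arch_id (sem G))
        \oA pick1 G (ZForm z Unit)
  (* The output of [p] lies in the zone [None]; [iblock] relabels it as an entry of zone [z] at the
     head of [ord D], and the inverse permutation moves it to where [q] expects it. *)
  | TZ_cut G D z A B p q =>
      interp q \oA reorder (etrans (perm_sym _ _) (perm_ordD1 D (ZForm z A)))
        \oA (iblock rho z A \xA arch_id (sem D))
        \oA (interp p \xA arch_id (sem D)) \oA split_sem G D
  | TZ_weak G z A B w p =>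
      interp p \oA lunit (sem G)
        \oA (discO w (fsem rho A) \xA arch_id (sem G))
        \oA pick1 G (ZForm z A)
  | TZ_contr G z A B c p =>
      interp p \oA put2 G (ZForm z A) (ZForm z A)
        \oA (diagO c (fsem rho A) \xA arch_id (sem G))
        \oA pick1 G (ZForm z A)
  end.

Lemma interp_Diag G A (pi : TZ (extracted_signature L) G A) :
  Diag rho L (interp pi).
Proof.
have reoD s t st : Diag rho L (@reorder s t st).
  exact/reordering_Diag/reorderP.
have idD s : Diag rho L (arch_id (csem rho s)) by exact: Diag_id.
elim: pi => {G A} [z A||G D A B p dp q dq|G z A B E p dp|G z E p dp
  |G D z A B p dp q dq|G z A B w p dp|G z A B c p dp]; cbn [interp].
- exact: Diag_comp (Diag_r rho L z A) (reoD _ _ (perm_ord1 (ZForm z A))).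
- exact: Diag_comp (Diag_e rho L) (reoD _ _ perm_ord0).
(* As [\oA] associates to the left, the rightmost factor, which rearranges the context, is peeled
   off first. *)
- apply: Diag_comp _ (split_sem_Diag _ _).
  exact: Diag_comp (Diag_t rho L A B) (Diag_tens dp dq).
- apply: Diag_comp _ (reoD _ _ (perm_ordD1 _ _)).
  apply: Diag_comp (Diag_comp dp (reoD _ _ (perm_ordD2 _ _ _))) _.
  exact: Diag_tens (Diag_m rho L z A B) (idD _).
- apply: Diag_comp _ (reoD _ _ (perm_ordD1 _ _)).
  apply: Diag_comp (Diag_comp dp (Diag_lunit _ _ _)) _.
  exact: Diag_tens (Diag_n rho L z) (idD _).
- apply: Diag_comp _ (split_sem_Diag _ _).
  apply: Diag_comp (Diag_tens dp (idD _)).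
  apply: Diag_comp (Diag_comp dq (reoD (ZForm z A :: ord D) _ _)) _.
  exact: Diag_tens (Diag_i rho L z A) (idD _).
- apply: Diag_comp _ (reoD _ _ (perm_ordD1 _ _)).
  apply: Diag_comp (Diag_comp dp (Diag_lunit _ _ _)) _.
  exact: Diag_tens (Diag_disc rho w (fsem rho A)) (idD _).
- apply: Diag_comp _ (reoD _ _ (perm_ordD1 _ _)).
  apply: Diag_comp (Diag_comp dp (reoD _ _ (perm_ordD2 _ _ _))) _.
  exact: Diag_tens (Diag_diag rho c (fsem rho A)) (idD _).
Qed.

End Interpretation.

Theorem theorem4p8 (C : fpcat) (Z : Type) (L : zone_discipline C Z)
    (atom : Type) (rho : atom -> C)
    (ord : zctx Z atom -> seq (zform Z atom))
    (ordK : forall G, seq_mset (ord G) = G) :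
  exists interp : forall (G : zctx Z atom) (A : form atom),
      TZ (extracted_signature L) G A ->
      arch (csem rho (ord G)) (Out rho A),
  [/\ forall G A (pi : TZ (extracted_signature L) G A), Diag rho L (interp G A pi),
      forall G z A B (w : weak (extracted_signature L) z)
          (pi : TZ (extracted_signature L) G B),
        exists2 sigma : arch (csem rho (ord (G `+` [mset ZForm z A])))
                             (csem rho (ZForm z A :: ord G)),
          reordering rho sigma &
          interp _ B (TZ_weak A w pi) =
            interp G B pi \oA lunit (csem rho (ord G))
              \oA (discO w (fsem rho A) \xA arch_id (csem rho (ord G)))
              \oA sigma &
      forall G z A B (c : contr (extracted_signature L) z)
          (pi : TZ (extracted_signature L)
                  (G `+` [mset ZForm z A] `+` [mset ZForm z A]) B),
        exists sigma : arch (csem rho (ord (G `+` [mset ZForm z A])))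
                            (csem rho (ZForm z A :: ord G)),
        exists sigma' : arch (csem rho (ZForm z A :: ZForm z A :: ord G))
            (csem rho (ord (G `+` [mset ZForm z A] `+` [mset ZForm z A]))),
          [/\ reordering rho sigma, reordering rho sigma' &
              interp _ B (TZ_contr c pi) =
                interp _ B pi \oA sigma'
                  \oA (diagO c (fsem rho A) \xA arch_id (csem rho (ord G)))
                  \oA sigma] ].
Proof.
exists (fun G A pi => interp rho ordK pi); split.
- by move=> G A pi; exact: interp_Diag.
(* With the reordering chosen in [interp] as witness, the equation is the [TZ_weak] clause itself
   and holds by computation; contraction is handled likewise. *)
- move=> G z A B w pi; exists (reorder rho (perm_ordD1 ordK G (ZForm z A))) => //.
  exact: reorderP.
- move=> G z A B c pi.
  exists (reorder rho (perm_ordD1 ordK G (ZForm z A))).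
  exists (reorder rho (perm_ordD2 ordK G (ZForm z A) (ZForm z A))).
  by split=> //; exact: reorderP.
Qed.
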